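(* Let $\Omega$ be a nonempty set and let $\Pi$ be a possibility measure on $\Omega$ with possibility distribution $\pi$ such that $\pi(\Omega)=\{\pi(x): x\in\Omega\}$ is compact. Then there is a total preorder $\preceq$ on $\Omega$ (with a smallest and a largest element $1_\Omega$) and an upper cumulative distribution function $\overline F$ on $(\Omega,\preceq)$ such that, with $\underline F=I_{[1_\Omega]_\simeq}$ (the indicator function of the equivalence class of $1_\Omega$), the p-box $(\underline F,\overline F)$ is a possibility measure with possibility distribution $\pi$, that is, for all $A\subseteq\Omega$, $$\overline E_{\underline F,\overline F}(A)=\sup_{x\in A}\pi(x).$$ In fact, one may take $\preceq$ to be the preorder induced by $\pi$ (so $x\preceq y$ if and only if $\pi(x)\le\pi(y)$) and $\overline F=\pi$.
   Context: A possibility distribution on $\Omega$ is a map $\pi:\Omega\to[0,1]$ with $\sup_{x\in\Omega}\pi(x)=1$; it induces the possibility measure $\Pi(A)=\sup_{x\in A}\pi(x)$ for $A\subseteq\Omega$ (with $\sup\emptyset=0$). For a total preorder $\preceq$ on $\Omega$ (reflexive, transitive, any two elements comparable) having a smallest element $0_\Omega$ and a largest element $1_\Omega$, write $x\simeq y$ if $x\preceq y$ and $y\preceq x$, and $[x]_\simeq=\{y: y\simeq x\}$. A cumulative distribution function on $(\Omega,\preceq)$ is a non-decreasing map $F:\Omega\to[0,1]$ with $F(1_\Omega)=1$ (no continuity is required). A p-box is a pair $(\underline F,\overline F)$ of cumulative distribution functions with $\underline F\le\overline F$ pointwise. Its natural extension is, for $A\subseteq\Omega$, $$\overline E_{\underline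 F,\overline F}(A)=\sup P(A),$$ the supremum over all finitely additive probabilities $P$ on the power set of $\Omega$ with $\underline F(x)\le P([0_\Omega,x])\le\overline F(x)$ for all $x\in\Omega$, where $[0_\Omega,x]=\{z\in\Omega: z\preceq x\}$. *)

(* Defs.v *)
From HB Require Import structures.
From mathcomp Require Import all_boot all_order all_algebra.
From mathcomp Require Import all_classical all_reals all_analysis.
Set Implicit Arguments.
Unset Strict Implicit.
Unset Printing Implicit Defensive.
Import Order.TTheory GRing.Theory Num.Theory.
Import numFieldNormedType.Exports.
Local Open Scope classical_set_scope.
Local Open Scope ring_scope.

(* All suprema below are the real-valued
   [sup] of subsets of [0, 1]; its value on the empty set is 0, which is the
   convention for the supremum of a possibility distribution over the empty
   event. *)

Definition possibility_distribution (R : realType) (Omega : Type)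
    (pi : Omega -> R) : Prop :=
  (forall x, 0 <= pi x <= 1) /\ sup (range pi) = 1.

Definition possibility_measure (R : realType) (Omega : Type)
    (Pi : set Omega -> R) (pi : Omega -> R) : Prop :=
  possibility_distribution pi /\ forall A : set Omega, Pi A = sup (pi @` A).

Definition total_preorder (Omega : Type) (le : rel Omega) : Prop :=
  [/\ reflexive le, transitive le & total le].

Definition smallest_elt (Omega : Type) (le : rel Omega) (x : Omega) : Prop :=
  forall y, le x y.

Definition largest_elt (Omega : Type) (le : rel Omega) (x : Omega) : Prop :=
  forall y, le y x.

Definition equiv_class (Omega : Type) (le : rel Omega) (x : Omega) : set Omega :=
  [set y | le y x /\ le x y].

(* The interval [0, x], where 0 is a smallest element. *)
Definition initial_segment (Omega : Type) (le : rel Omega) (x : Omega) :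
    set Omega :=
  [set z | le z x].

Definition cdf_on (R : realType) (Omega : Type) (le : rel Omega) (top : Omega)
    (F : Omega -> R) : Prop :=
  [/\ forall x, 0 <= F x <= 1,
      {homo F : x y / le x y >-> x <= y} &
      F top = 1].

Definition pbox (R : realType) (Omega : Type) (le : rel Omega) (top : Omega)
    (Flow Fup : Omega -> R) : Prop :=
  [/\ cdf_on le top Flow, cdf_on le top Fup & forall x, Flow x <= Fup x].

Definition fin_additive_probability (R : realType) (Omega : Type)
    (P : set Omega -> R) : Prop :=
  [/\ forall A, 0 <= P A,
      P setT = 1 &
      forall A B, A `&` B = set0 -> P (A `|` B) = P A + P B].

Definition pbox_credal_set (R : realType) (Omega : Type) (le : rel Omega)
    (Flow Fup : Omega -> R) : set (set Omega -> R) :=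
  [set P | fin_additive_probability P /\
           forall x, Flow x <= P (initial_segment le x) <= Fup x].

(* If the credal set were empty this would be 0 for every event, in particular
   for [setT]; a natural extension that is a possibility measure, hence takes
   the value 1 on [setT], is therefore a genuine supremum. *)
Definition natural_extension (R : realType) (Omega : Type) (le : rel Omega)
    (Flow Fup : Omega -> R) (A : set Omega) : R :=
  sup [set P A | P in pbox_credal_set le Flow Fup].

Definition preorder_induced (R : realType) (Omega : Type) (pi : Omega -> R) :
    rel Omega :=
  fun x y => pi x <= pi y.

(* [le] is a total preorder with a smallest and a largest element, and the
   p-box whose lower distribution function is the indicator of the class of the
   largest element and whose upper one is [Fup] is a possibility measure with
   distribution [pi].  The class does not depend on the largest element
   chosen. *)
Definition pbox_represents (R : realType) (Omega : Type) (le : rel Omega)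
    (Fup pi : Omega -> R) : Prop :=
  exists bot top : Omega,
    [/\ total_preorder le, smallest_elt le bot, largest_elt le top,
        pbox le top (\1_(equiv_class le top)) Fup &
        possibility_measure
          (natural_extension le (\1_(equiv_class le top)) Fup) pi].

(* Main.v *)
Require Import Defs.
From HB Require Import structures.
From mathcomp Require Import all_boot all_order all_algebra.
From mathcomp Require Import all_classical all_reals all_analysis.
From mathcomp Require Import ring lra.
Set Implicit Arguments.
Unset Strict Implicit.
Unset Printing Implicit Defensive.
Import Order.TTheory GRing.Theory Num.Theory.
Import numFieldNormedType.Exports.
Local Open Scope classical_set_scope.
Local Open Scope ring_scope.

(** Order [Omega] by [pi] and let [top] be a point where [pi] is [1].  Since
    [range pi] is closed, a nonempty event [A] is contained in an initial
    segment [[0, x]] with [pi x = sup (pi @` A)], so every probability in the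
    credal set gives [A] mass at most [sup (pi @` A)].  Conversely, for each
    [a] in [A], mass [pi a] at [a] and mass [1 - pi a] at [top] is a
    probability in the credal set giving [A] mass at least [pi a]. *)

Section FinitelyAdditiveProbability.
Context {R : realType} {Omega : Type}.
Implicit Types (P : set Omega -> R) (A B : set Omega).

Lemma fin_additive_probability0 P : fin_additive_probability P -> P set0 = 0.
Proof.
move=> [_ _ Padd]; have := Padd set0 set0 (setI0 _).
by rewrite setU0; lra.
Qed.

Lemma fin_additive_probability_le P A B :
  fin_additive_probability P -> A `<=` B -> P A <= P B.
Proof.
move=> [P_ge0 _ Padd] AB; rewrite -(setDUK AB) Padd ?setDIK//.
by rewrite lerDl.
Qed.

(** A convex combination of the point masses at [a] and [b]; additivity comes from that of
    indicators on disjoint sets. *)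
Lemma two_point_probability (p : R) (a b : Omega) : 0 <= p <= 1 ->
  fin_additive_probability (fun A => p * \1_A a + (1 - p) * \1_A b).
Proof.
move=> /andP[p_ge0 p_le1]; split.
- by move=> A; rewrite addr_ge0// mulr_ge0// ?subr_ge0// indicE ler0n.
- by rewrite !indicE !in_setT !mulr1 subrKC.
- move=> A B AB0; have ind x : \1_(A `|` B) x = \1_A x + \1_B x :> R.
    (* Disjointness, read at [x], rules out the case where [x] lies in both sets. *)
    have := congr1 (fun C => x \in C) AB0; rewrite in_setI in_set0 !indicE in_setU.
    by case: (x \in A); case: (x \in B) => //=; rewrite ?addr0 ?add0r.
  by rewrite !ind; ring.
Qed.

End FinitelyAdditiveProbability.

Section Possibility.
Context {R : realType} {Omega : Type}.
Variable pi : Omega -> R.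

Lemma preorder_induced_total : total_preorder (preorder_induced pi).
Proof.
rewrite /preorder_induced; split.
- by move=> x; exact: lexx.
- by move=> y x z; exact: le_trans.
- by move=> x y; exact: le_total.
Qed.

Hypothesis pi01 : forall x, 0 <= pi x <= 1.

Lemma image_has_ubound (A : set Omega) : has_ubound (pi @` A).
Proof. by exists 1 => _ [x _ <-]; have /andP[] := pi01 x. Qed.

(** The supremum of a nonempty bounded set lies in its closure, hence here in the closed set
    [range pi]. The point [x] may lie outside [A]. *)
Lemma image_sup_attained (A : set Omega) :
  closed (range pi) -> A !=set0 -> exists x, pi x = sup (pi @` A).
Proof.
move=> pi_closed A0.
have A0' : pi @` A !=set0 by apply: image_nonempty.
have [] := pi_closed (sup (pi @` A)).
  apply: closureS (closure_sup A0' (image_has_ubound A)).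
  exact: image_subset.
by move=> x _ <-; exists x.
Qed.

Variable top : Omega.
Hypothesis pi_top : pi top = 1.

Let Flow : Omega -> R := \1_(Defs.equiv_class (preorder_induced pi) top).

(** As [pi top = 1] is the maximum of [pi], the class of [top] is the level set where [pi] equals
    1. *)
Lemma mem_top_class x :
  (x \in Defs.equiv_class (preorder_induced pi) top) = (1 <= pi x).
Proof.
rewrite /Defs.equiv_class /preorder_induced pi_top; apply/idP/idP.
  by rewrite inE => -[].
by move=> h; rewrite inE; split => //; have /andP[] := pi01 x.
Qed.

Lemma induced_pbox : pbox (preorder_induced pi) top Flow pi.
Proof.
rewrite /Flow; split; [split|split|].
- by move=> x; rewrite indicE; case: (_ \in _); rewrite ?lexx ler01.
- move=> x y; rewrite /preorder_induced !indicE !mem_top_class ler_nat => xy.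
  by have [x1|//] := boolP (1 <= pi x); rewrite (le_trans x1 xy).
- by rewrite indicE mem_top_class pi_top lexx.
- exact: pi01.
- by move=> x y.
- exact: pi_top.
- move=> x; rewrite indicE mem_top_class; have /andP[? ?] := pi01 x.
  by have [|] := leP 1 (pi x).
Qed.

(** If [pi x = 1], the segment up to [x] is everything and has mass 1. Otherwise it misses [top], so
    its mass is [pi a] when [pi a <= pi x] and 0 when not; either way it is at most [pi x]. *)
Lemma two_point_in_credal (a : Omega) :
  pbox_credal_set (preorder_induced pi) Flow pi
    (fun A => pi a * \1_A a + (1 - pi a) * \1_A top).
Proof.
split; first exact/two_point_probability/pi01.
move=> x; rewrite /Flow !indicE.
have segE y : (y \in initial_segment (preorder_induced pi) x) = (pi y <= pi x).
  by apply/idP/idP; rewrite inE.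
rewrite mem_top_class !segE pi_top.
have /andP[a0 a1] := pi01 a; have /andP[x0 x1] := pi01 x.
have [x_ge1|x_lt1] := leP 1 (pi x).
  by rewrite (le_trans a1 x_ge1) !mulr1 subrKC lexx.
rewrite mulr0 addr0 mulr_ge0 ?ler0n//=.
by have [ax|ax] := leP (pi a) (pi x); rewrite ?mulr1 ?mulr0.
Qed.

Lemma credal_le_sup (P : set Omega -> R) (A : set Omega) :
  closed (range pi) -> A !=set0 ->
  pbox_credal_set (preorder_induced pi) Flow pi P -> P A <= sup (pi @` A).
Proof.
move=> pi_closed A0 [P_prob P_bound].
have [x pix] := image_sup_attained pi_closed A0.
rewrite -pix; have /andP[_] := P_bound x; apply: le_trans.
apply: fin_additive_probability_le => // a Aa.
rewrite /initial_segment /preorder_induced /= pix.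
by apply: (ub_le_sup (image_has_ubound A)); exists a.
Qed.

Lemma natural_extension_induced (A : set Omega) : closed (range pi) ->
  natural_extension (preorder_induced pi) Flow pi A = sup (pi @` A).
Proof.
move=> pi_closed; rewrite /natural_extension.
(* A supremum is bounded by an upper bound only over a nonempty set; the point mass at [top] is the
   witness. *)
have credal0 : [set P A | P in
    pbox_credal_set (preorder_induced pi) Flow pi] !=set0.
  by apply: image_nonempty; eexists; exact: (two_point_in_credal top).
(* For the empty event the right side is the default value 0 of [sup], and every probability also
   gives 0. *)
have [->|/set0P A0] := eqVneq A set0.
  rewrite image_set0 sup0 (_ : [set _ | _ in _] = [set 0]) ?sup1//.
  apply/seteqP; split=> [_ [P [P_prob _] <-]|_ ->] /=.
    exact: fin_additive_probability0.
  have cred := two_point_in_credal top.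
  by eexists; [exact: cred|exact: fin_additive_probability0 cred.1].
have bounded : ubound [set P A | P in
    pbox_credal_set (preorder_induced pi) Flow pi] (sup (pi @` A)).
  by move=> _ [P credP <-]; exact: credal_le_sup.
apply/eqP; rewrite eq_le; apply/andP; split; first exact: ge_sup.
apply: ge_sup; first exact: image_nonempty.
move=> _ [a Aa <-].
(* The mass at [a] alone already contributes [pi a]; the mass at [top] can only add to it. *)
apply: (@le_trans _ _ (pi a * \1_A a + (1 - pi a) * \1_A top)).
  rewrite [\1_A a]indicE mem_set// mulr1 lerDl mulr_ge0// subr_ge0.
  by have /andP[] := pi01 a.
apply: ub_le_sup; first by exists (sup (pi @` A)).
by exists (fun B => pi a * \1_B a + (1 - pi a) * \1_B top);
  first exact: two_point_in_credal.
Qed.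

End Possibility.

Theorem theorem18 (R : realType) (Omega : Type) (Omega_nonempty : inhabited Omega)
    (Pi : set Omega -> R) (pi : Omega -> R)
    (Pi_possibility : possibility_measure Pi pi)
    (pi_compact : compact (range pi)) :
  (exists (le : rel Omega) (Fup : Omega -> R), pbox_represents le Fup pi) /\
  pbox_represents (preorder_induced pi) pi pi.
Proof.
suff repr : pbox_represents (preorder_induced pi) pi pi.
  by split => //; exists (preorder_induced pi), pi.
have [pi_distr _] := Pi_possibility; have [pi01 sup1] := pi_distr.
have [x0] := Omega_nonempty.
have range0 : range pi !=set0 by exists (pi x0); exists x0.
have pi_closed := compact_closed (@Rhausdorff R) pi_compact.
(* A smallest element is a point where [pi] is minimal: the identity attains its minimum on the
   compact set [range pi]. *)
have [m] := @compact_EVT_min _ R id _ range0 pi_compact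
  (continuous_subspaceT (fun=> cvg_id)).
rewrite inE => -[bot _ <-] bot_min.
(* The supremum of [pi] over the whole space is 1, so the point attaining it is a largest
   element. *)
have [|top pi_top] := image_sup_attained pi01 pi_closed (A := setT).
  by exists x0.
rewrite {}sup1 in pi_top.
exists bot, top; split.
- exact: preorder_induced_total.
- by move=> y; apply: bot_min; rewrite inE; exists y.
- by move=> y; rewrite /preorder_induced pi_top; have /andP[] := pi01 y.
- exact: induced_pbox.
- by split=> // A; exact: natural_extension_induced.
Qed.
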